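(* Let $G=\{V,E\}$ be an $m\times n$ GIG digraph containing the directed path $(V_1,\ldots,V_i)$. For $1\le j\le i-1$ let $K_j=|N(V_1,\ldots,V_j)|$. Then the probability that a randomly labeled $m\times n$ GIG digraph contains the directed path $(V_1,\ldots,V_i)$ is $$\frac{1}{K_1}\cdot\frac{1}{K_2}\cdots\frac{1}{K_{i-1}}.$$
   Context: The vertex set $V$ is the $m\times n$ integer lattice $\{1,\ldots,m\}\times\{1,\ldots,n\}$. Two vertices are called neighbors if they are at Euclidean distance exactly $1$ in the lattice (neighbor refers to lattice proximity, not to adjacency in the digraph). For $W\subset V$, $N(W)$ is the set consisting of the vertices of $W$ together with all neighbors of vertices of $W$; $N(V_1,\ldots,V_j)$ means $N(\{V_1,\ldots,V_j\})$. A labeling is a bijection from $V$ to $\{1,\ldots,mn\}$; the label of $V_a$ is denoted $v_a$, and $n(W)$ denotes the set of labels of the vertices in $N(W)$. The GIG (Greatest Increase Grid) digraph of a labeling is the digraph on $V$ in which $(V_a,V_b)$ is a directed edge if and only if $a\ne b$ and $v_b=\max n(\{V_a\})$. An $m\times n$ GIG digraph is the digraph obtained in this way from some labeling. A directed path $(V_1,\ldots,V_i)$ is contained in the digraph if $(V_j,V_{j+1})$ is an edge for each $1\le j\le i-1$. A randomly labeled $m\times n$ GIG digraph is the GIG digraph of a labeling chosen uniformly at random among all $(mn)!$ labelings. *)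

(* Defs.v *)
From mathcomp Require Import all_boot all_order all_algebra all_field.

Set Implicit Arguments.
Unset Strict Implicit.
Unset Printing Implicit Defensive.

Import GRing.Theory Num.Theory.

Local Open Scope ring_scope.

(* The lattice {1..m} x {1..n}, with coordinates shifted to start at 0. *)
Definition vertex (m n : nat) : finType := ('I_m * 'I_n)%type.

(* The algebraic numbers serve only as a field with square roots. *)
Definition euclid_dist (m n : nat) (u v : vertex m n) : algC :=
  sqrtC ((u.1%:R - v.1%:R) ^+ 2 + (u.2%:R - v.2%:R) ^+ 2).

Definition neighbor (m n : nat) : rel (vertex m n) :=
  fun u v => euclid_dist u v == 1.

Definition nbhd (m n : nat) (W : {set vertex m n}) : {set vertex m n} :=
  W :|: [set v | [exists w in W, neighbor w v]].

(* Bijections onto 'I_(m * n); the label proper, in {1..mn}, is [label]. *)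
Definition labelings (m n : nat) : {set {ffun vertex m n -> 'I_(m * n)}} :=
  [set L : {ffun vertex m n -> 'I_(m * n)} |
     injectiveb L && [forall k, k \in codom L]].

Definition label (m n : nat) (L : {ffun vertex m n -> 'I_(m * n)})
  (v : vertex m n) : nat := (L v).+1.

Definition gig (m n : nat) (L : {ffun vertex m n -> 'I_(m * n)}) :
    rel (vertex m n) :=
  fun a b => (a != b) && (label L b == \max_(u in nbhd [set a]) label L u)%N.

Definition is_gig (m n : nat) (G : rel (vertex m n)) : Prop :=
  exists2 L, L \in labelings m n & G =2 gig L.

(* For p = (V_1, ..., V_i) and 1 <= j <= i, this is K_j = |N(V_1, ..., V_j)|. *)
Definition path_nbhd_card (m n : nat) (p : seq (vertex m n)) (j : nat) : nat :=
  #|nbhd [set v in take j p]|.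

Definition prob_labeling (m n : nat)
    (E : pred {ffun vertex m n -> 'I_(m * n)}) : rat :=
  #|[set L in labelings m n | E L]|%:R / #|labelings m n|%:R.

Lemma card_labelings (m n : nat) : #|labelings m n| = (m * n)`!.
Proof.
have cV : #|vertex m n| = #|'I_(m * n)| by rewrite card_prod !card_ord.
rewrite -[in RHS](card_ord (m * n)) -ffactnn -{2}cV -card_inj_ffuns.
apply: eq_card => L; rewrite !inE andb_idr // => /injectiveP injL.
by apply/forallP => k; apply: inj_card_onto; rewrite // cV.
Qed.

(* Main.v *)
(* Write S_j = N(V_1, ..., V_j).  Along a path of the digraph the labels
   increase, so a labeling contains the path iff, for every j < i, V_(j+1)
   carries the largest label of S_j; moreover V_(j+1) lies in S_j but in no
   earlier S_k, since the path occurs in at least one digraph.  Impose these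
   constraints from the last one back to the first.  For y in S_j, exchanging
   the labels of y and V_(j+1) preserves the constraints of index greater than
   j, because the sets S_k with k > j contain both vertices while their maxima
   lie outside S_j.  Hence each of the K_j elements of S_j is equally likely to
   carry its largest label, and the j-th constraint divides the number of
   labelings by K_j. *)
Require Import Defs.
From mathcomp Require Import all_boot all_order all_algebra all_field.
From mathcomp Require Import fingroup perm.

Import GRing.Theory Num.Theory.

Section PrescribedMaxima.

Set Implicit Arguments.
Unset Strict Implicit.

Variables (T : finType) (N : nat).
Implicit Types (f : {ffun T -> 'I_N}) (c d : {set T} * T).
Implicit Types (s : seq ({set T} * T)).

(** A constraint pairs a set with the point meant to dominate it; that the point lies in the set is
    imposed separately. *)
Definition maximal_at f c := [forall u in c.1, f u <= f c.2].

Definition injections_max s : {set {ffun T -> 'I_N}} :=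
  [set f : {ffun T -> 'I_N} | injectiveb f && all (maximal_at f) s].

(** Swapping two points of [c.1] then fixes the set [d.1] and the point [d.2], hence preserves the
    constraint [d]. *)
Definition precedes c d := (c.1 \subset d.1) && (d.2 \notin c.1).

Lemma maximal_at_tperm f c x y : maximal_at [ffun z => f (tperm x y z)] c =
  maximal_at f (tperm x y @^-1: c.1, tperm x y c.2).
Proof.
apply/forall_inP/forall_inP => /= H u uc.
  by have := H (tperm x y u); rewrite !ffunE tpermK inE in uc *; apply.
by rewrite !ffunE; apply: H; rewrite inE tpermK.
Qed.

Lemma tperm_preim (A : {set T}) x y :
  x \in A -> y \in A -> tperm x y @^-1: A = A.
Proof.
move=> xA yA; apply/setP => z; rewrite inE.
by case: tpermP => // ->; rewrite xA yA.
Qed.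

(** Precomposition with the transposition of [x] and [y] injects one set into the other; exchanging
    [x] and [y] gives the reverse inequality. *)
Lemma card_maximal_sym (A : {set T}) x y s :
  x \in A -> y \in A -> all (precedes (A, x)) s ->
  #|injections_max ((A, y) :: s)| <= #|injections_max ((A, x) :: s)|.
Proof.
move=> xA yA /allP As.
pose swap f := [ffun z => f (tperm x y z)].
have swapK : involutive swap.
  by move=> f; apply/ffunP => z; rewrite !ffunE tpermK.
rewrite -(card_imset _ (can_inj swapK)); apply/subset_leq_card/subsetP => g.
case/imsetP => f; rewrite !inE /= => /and3P[/injectiveP injf fy /allP fs] ->.
apply/and3P; split.
- by apply/injectiveP => u v; rewrite !ffunE => /injf /perm_inj.
- by rewrite maximal_at_tperm /= tperm_preim // tpermL.
- apply/allP => -[B z] Bs; have /andP[/= /subsetP AB zA] := As _ Bs.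
  rewrite maximal_at_tperm /= tperm_preim ?AB // tpermD; first exact: fs.
    by apply: contraNneq zA => <-.
  by apply: contraNneq zA => <-.
Qed.

Lemma card_injections_max_cons (A : {set T}) x s :
  x \in A -> all (precedes (A, x)) s ->
  #|injections_max s| = #|A| * #|injections_max ((A, x) :: s)|.
Proof.
move=> xA As; rewrite -sum_nat_const -sum1_card.
(* Classify the injections by the point of [A] where they peak; [x] witnesses that [A] is
   nonempty. *)
rewrite (partition_big (fun f => [arg max_(z > x in A) f z]) (mem A)) /=;
  last first.
  by move=> f _; case: arg_maxnP.
apply: eq_bigr => y yA.
(* [precedes] depends on its first pair only through the set. *)
have As' : all (precedes (A, y)) s by [].
transitivity #|injections_max ((A, y) :: s)|; last first.
  by apply/eqP; rewrite eqn_leq !card_maximal_sym.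
rewrite -sum1_card; apply: eq_bigl => f; rewrite !inE /= andbAC [RHS]andbA.
congr (_ && _); case: injectiveP => //= injf.
case: arg_maxnP => // z zA zmax; apply/eqP/forall_inP => [<- // | ymax].
by apply/injf/val_inj/anti_leq; rewrite ymax //; apply: zmax.
Qed.

Lemma card_injections_max s :
  all (fun c => c.2 \in c.1) s -> pairwise precedes s ->
  #|injections_max [::]| = (\prod_(c <- s) #|c.1|) * #|injections_max s|.
Proof.
elim: s => [|[A x] s IHs] /=; first by rewrite big_nil mul1n.
case/andP=> xA s_in /andP[As ps].
by rewrite big_cons IHs // (card_injections_max_cons xA As) mulnA (mulnC #|A|).
Qed.

End PrescribedMaxima.

Section GigPaths.

Set Implicit Arguments.
Unset Strict Implicit.

Variables (m n : nat).
Implicit Types (L : {ffun vertex m n -> 'I_(m * n)}) (p : seq (vertex m n)).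

Lemma labelingsE : labelings m n = injections_max (m * n) [::].
Proof.
apply/setP => L; rewrite !inE andbT andb_idr // => /injectiveP injL.
by apply/forallP => k; apply: inj_card_onto; rewrite // card_prod !card_ord.
Qed.

Lemma labelings_inj L : L \in labelings m n -> injective L.
Proof. by rewrite inE => /andP[/injectiveP]. Qed.

Lemma mem_nbhd1 (a : vertex m n) : a \in nbhd [set a].
Proof. by rewrite !inE eqxx. Qed.

Lemma mem_nbhdP p (u : vertex m n) :
  reflect (exists2 w, w \in p & u \in nbhd [set w]) (u \in nbhd [set v in p]).
Proof.
rewrite !inE; apply: (iffP orP) => [[up | /exists_inP[w]] | [w wp]].
- by exists u; rewrite ?mem_nbhd1.
- rewrite inE => wp wu; exists w; rewrite // !inE; apply/orP; right.
  by apply/exists_inP; exists w; rewrite ?inE.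
- rewrite !inE => /orP[/eqP-> | /exists_inP[z]]; first by left.
  rewrite inE => /eqP-> wu; right.
  by apply/exists_inP; exists w; rewrite ?inE.
Qed.

Lemma gigP L (a b : vertex m n) : injective L ->
  reflect [/\ a != b, b \in nbhd [set a] &
              {in nbhd [set a], forall u, L u <= L b}] (gig L a b).
Proof.
move=> injL; apply: (iffP andP) => [[ab /eqP maxb] | [ab bN maxb]]; split=> //.
(* The maximum over a nonempty set is attained at some [u], and injectivity forces [u] to be [b]. *)
- have [|u uN] := @eq_bigmax_cond _ (mem (nbhd [set a])) (label L).
    by apply/card_gt0P; exists a; apply: mem_nbhd1.
  by rewrite -maxb => -[] /val_inj /injL ->.
- by move=> u uN; rewrite -ltnS -/(label L b) maxb (leq_bigmax_cond _ uN).
- rewrite eqn_leq (leq_bigmax_cond _ bN) //=.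
  by apply/bigmax_leqP => u uN; rewrite ltnS maxb.
Qed.

Variables (p : seq (vertex m n)) (x0 : vertex m n).

(** As [nth] counts from 0, index [j] pairs N(V_1, ..., V_j) with V_(j+1). *)
Definition path_constraints :=
  [seq (nbhd [set v in take j p], nth x0 p j) | j <- iota 1 (size p).-1].

Lemma mem_path_constraints j : j \in iota 1 (size p).-1 = (0 < j < size p).
Proof. by rewrite mem_iota; case: (size p) => [|k]; case: j. Qed.

Lemma mem_nbhd_take u j : j <= size p -> u \in nbhd [set v in take j p] ->
  exists2 k, k < j & u \in nbhd [set nth x0 p k].
Proof.
move=> jp /mem_nbhdP[w /(nthP x0)[k]]; rewrite size_takel // => kj <-.
by rewrite nth_take // => uN; exists k.
Qed.

Lemma nbhd_take_nth u j k : k < j -> k < size p ->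
  u \in nbhd [set nth x0 p k] -> u \in nbhd [set v in take j p].
Proof.
move=> kj kp uN; apply/mem_nbhdP; exists (nth x0 p k) => //.
by rewrite -(nth_take _ kj) mem_nth // size_take; case: ifP.
Qed.

Section Realized.

Variable L : {ffun vertex m n -> 'I_(m * n)}.
Hypotheses (injL : injective L) (Lp : sorted (gig L) p).

Let step k (kp : k.+1 < size p) := gigP _ _ injL (sortedP x0 Lp k kp).

Lemma gig_path_ltn j k : j < k -> k < size p -> L (nth x0 p j) < L (nth x0 p k).
Proof.
elim: k => // k IHk; rewrite ltnS leq_eqVlt => jk kp.
have [neq _ /(_ _ (mem_nbhd1 _)) le_k] := step kp.
have lt_k : L (nth x0 p k) < L (nth x0 p k.+1).
  by rewrite ltn_neqAle le_k andbT; apply: contraNneq neq => /val_inj/injL->.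
case/predU1P: jk => [-> // | jk].
exact: ltn_trans (IHk jk (ltnW kp)) lt_k.
Qed.

(** Such a [u] is near a single earlier vertex, whose successor dominates it; labels then increase
    along the path up to index [j]. *)
Lemma gig_path_max u j : j < size p -> u \in nbhd [set v in take j p] ->
  L u <= L (nth x0 p j).
Proof.
move=> jp /(mem_nbhd_take (ltnW jp))[k kj uN].
have [_ _ /(_ u uN) le_u] := step (leq_ltn_trans kj jp).
apply: leq_trans le_u _; move: kj; rewrite leq_eqVlt => /predU1P[-> // | kj].
exact/ltnW/gig_path_ltn.
Qed.

Lemma path_constraints_max : all (maximal_at L) path_constraints.
Proof.
rewrite all_map; apply/allP => j; rewrite mem_path_constraints => /andP[_ jp].
by apply/forall_inP => u; apply: gig_path_max.
Qed.

Lemma path_constraints_in :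
  all (fun c : {set _} * _ => c.2 \in c.1) path_constraints.
Proof.
rewrite all_map; apply/allP => -[|j]; rewrite mem_path_constraints //= => jp.
have [_ jN _] := step jp.
exact: nbhd_take_nth (ltnSn j) (ltnW jp) jN.
Qed.

Lemma path_constraints_precedes : pairwise (@precedes _) path_constraints.
Proof.
rewrite pairwise_map.
apply: (@sub_in_pairwise _ (mem (iota 1 (size p).-1)) ltn); last 1 first.
- by rewrite -sorted_pairwise ?iota_ltn_sorted //; apply: ltn_trans.
- move=> j k; rewrite !mem_path_constraints /= => /andP[_ jp] /andP[_ kp] jk.
  apply/andP; split=> /=.
    apply/subsetP => u /(mem_nbhd_take (ltnW jp))[l lj].
    by apply: nbhd_take_nth; [apply: ltn_trans jk | apply: ltn_trans jp].
  (* If the later vertex lay in the earlier set, its label could not exceed that of the earlier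
     vertex, yet labels increase. *)
  by apply: contraL (gig_path_ltn jk kp) => /(gig_path_max jp); rewrite -leqNgt.
- exact/allP.
Qed.

(** Distinctness and proximity of consecutive vertices do not depend on the labeling, so they are
    inherited from [L]; only maximality must come from [L']. *)
Lemma sorted_gig_constraints L' : injective L' ->
  all (maximal_at L') path_constraints -> sorted (gig L') p.
Proof.
move=> injL'; rewrite all_map => /allP maxL'; apply/(sortedP x0) => j jp.
have [neq jN _] := step jp; apply/gigP => //; split=> // u uN.
have /maxL'/forall_inP/(_ u) : j.+1 \in iota 1 (size p).-1.
  by rewrite mem_path_constraints.
by apply; apply: nbhd_take_nth (ltnSn j) (ltnW jp) uN.
Qed.

End Realized.

End GigPaths.

Local Open Scope ring_scope.

Theorem theorem2p1 (m n i : nat) (G : rel (vertex m n))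
    (V : i.-tuple (vertex m n)) :
  (0 < i)%N ->
  is_gig G ->
  sorted G V ->
  prob_labeling (fun L => sorted (gig L) V) =
    \prod_(1 <= j < i) (1 / (path_nbhd_card V j)%:R).
Proof.
move=> i_gt0 [L0 /labelings_inj injL0 GE].
rewrite (eq_sorted GE) => L0V.
pose x0 := tnth V (Ordinal i_gt0).
pose s := path_constraints V x0.
have -> : prob_labeling (fun L => sorted (gig L) V) =
    #|injections_max (m * n) s|%:R / #|labelings m n|%:R.
  congr (_%:R / _); apply: eq_card => L.
  rewrite labelingsE !inE /= andbT; case: injectiveP => //= injL.
  apply/idP/idP; first exact: path_constraints_max.
  exact: (sorted_gig_constraints injL0 L0V injL).
have cardL := card_injections_max (m * n)
  (path_constraints_in x0 injL0 L0V) (path_constraints_precedes x0 injL0 L0V).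
have := card_labelings m n; rewrite labelingsE cardL => card_fact.
(* The factorial is the product of the K_j times the constrained count, so that count is nonzero and
   cancels. *)
have : (0 < (m * n)`!)%N := fact_gt0 _.
rewrite -card_fact muln_gt0 => /andP[_ cs_gt0].
rewrite natrM invfM mulrCA divff ?pnatr_eq0 -?lt0n // mulr1.
rewrite big_map /= size_tuple /path_nbhd_card.
under [RHS]eq_bigr do rewrite div1r.
by rewrite natr_prod prodfV /index_iota subn1.
Qed.
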